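(* Let $\mathbb{F}=\mathbb{R}$ or $\mathbb{C}$, $n\ge1$, $A\in\mathbb{F}^{n\times n}$, let $\mathcal{S}$ be a $p$-dimensional linear subspace of $\mathbb{F}^n$, let $q=\mathrm{Ind}_A(\mathcal{S})$, and define $\mathcal{S}':=\mathcal{S}^\perp\cap(\mathcal{S}+A\mathcal{S})$. Then: (i) If $A_\omega:=A+\omega I$ with $\omega\in\mathbb{F}$, then $\mathrm{Ind}_{A_\omega}(\mathcal{S})=q$. (ii) $\mathrm{Ind}_A(\mathcal{S}^\perp)\le\min\{p,n-p\}\le\lfloor n/2\rfloor$; $\mathrm{Ind}_A(\mathcal{S}+A\mathcal{S})\le\min\{q,n-p-q\}\le\lfloor(n-p)/2\rfloor$; and $\mathrm{Ind}_A(\mathcal{S}')\le q$. (iii) If $A$ is invertible, then $\mathrm{Ind}_{A^{-1}}(\mathcal{S})=q$. (iv) If $A$ is Hermitian, then $\mathrm{Ind}_A(\mathcal{S}^\perp)=q$ and $\mathrm{Ind}_A(\mathcal{S}')=q$. Thus if $A$ is Hermitian and $q=0$, both $\mathcal{S}$ and $\mathcal{S}^\perp$ are $A$-invariant, and if moreover $A$ is invertible, both $\mathcal{S}$ and $\mathcal{S}^\perp$ are also $A^{-1}$-invariant. (v) If $A$ is Hermitian positive definite and $\mathrm{Ind}_A(\mathcal{S})=0$, then $\mathrm{Ind}_{A^s}(\mathcal{S})=0$ for every $s\in\mathbb{R}$.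
   Context: The index of invariance of a subspace $\mathcal{S}\subseteq\mathbb{F}^n$ with respect to $A\in\mathbb{F}^{n\times n}$ is $\mathrm{Ind}_A(\mathcal{S}):=\dim(\mathcal{S}+A\mathcal{S})-\dim(\mathcal{S})$, where $A\mathcal{S}=\{Ax:x\in\mathcal{S}\}$. $\mathcal{S}$ is $A$-invariant if $A\mathcal{S}\subseteq\mathcal{S}$. For Hermitian positive definite $A=U\Lambda U^*$ ($U$ unitary, $\Lambda$ diagonal with positive entries), $A^s:=U\Lambda^sU^*$. $\perp$ is the orthogonal complement for the standard inner product. *)

(* Defs.v *)
From HB Require Import structures.
From mathcomp Require Import all_boot all_order all_algebra.
From mathcomp Require Import complex.
From mathcomp Require Import boolp classical_sets reals exp.

Set Implicit Arguments.
Unset Strict Implicit.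
Unset Printing Implicit Defensive.

Import Order.TTheory GRing.Theory Num.Theory.
Local Open Scope ring_scope.

(* The real and complex fields, so that a statement over F = R or C is a
   single statement quantified over base_field. *)
Variant base_field := Reals | Complexes.

Definition field_of (R : realType) (K : base_field) : numFieldType :=
  match K with Reals => R | Complexes => R[i] end.

Definition scalar_conj (R : realType) (K : base_field) :
    field_of R K -> field_of R K :=
  match K with Reals => idfun | Complexes => @Num.conj R[i] end.
Arguments scalar_conj {R K}.

Definition of_real (R : realType) (K : base_field) : R -> field_of R K :=
  match K with Reals => idfun | Complexes => real_complex R end.
Arguments of_real {R K}.

Section Conj.
Variables (R : realType) (K : base_field).

Fact scalar_conj_additive : zmod_morphism (@scalar_conj R K).
Proof. by case: K => // x y; rewrite /= rmorphB. Qed.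

Fact scalar_conj_multiplicative : monoid_morphism (@scalar_conj R K).
Proof.
by case: K; split => //= [|x y]; rewrite ?rmorph1 ?rmorphM.
Qed.

HB.instance Definition _ := GRing.isZmodMorphism.Build _ _ (@scalar_conj R K)
  scalar_conj_additive.
HB.instance Definition _ := GRing.isMonoidMorphism.Build _ _ (@scalar_conj R K)
  scalar_conj_multiplicative.

Fact scalar_conjK : involutive (@scalar_conj R K).
Proof. by case: K => // x; exact: conjCK. Qed.

HB.instance Definition _ := isInvolutive.Build _ (@scalar_conj R K)
  scalar_conjK.

Fact of_real_additive : zmod_morphism (@of_real R K).
Proof. by case: K => // x y; rewrite /= rmorphB. Qed.

Fact of_real_multiplicative : monoid_morphism (@of_real R K).
Proof.
by case: K; split => [|x y] //=; rewrite ?rmorph1 ?rmorphM.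
Qed.

HB.instance Definition _ := GRing.isZmodMorphism.Build _ _ (@of_real R K)
  of_real_additive.
HB.instance Definition _ := GRing.isMonoidMorphism.Build _ _ (@of_real R K)
  of_real_multiplicative.

End Conj.

Definition ctrmx (R : realType) (K : base_field) m n
    (A : 'M[field_of R K]_(m, n)) : 'M[field_of R K]_(n, m) :=
  map_mx scalar_conj A^T.
Notation "A ^H" := (ctrmx A) (at level 2, format "A ^H") : ring_scope.

Definition inner (R : realType) (K : base_field) n
    (x y : 'cV[field_of R K]_n) : field_of R K := (y^H *m x) 0 0.

Section Inner.
Variables (R : realType) (K : base_field) (n : nat).
Implicit Types x y : 'cV[field_of R K]_n.

Lemma innerE x y : inner x y = \sum_i x i 0 * scalar_conj (y i 0).
Proof.
by rewrite /inner mxE; apply: eq_bigr => i _; rewrite !mxE mulrC.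
Qed.

Fact inner_bilinear :
  bilinear_for *%R (scalar_conj \; *%R) (@inner R K n).
Proof.
split=> y a x x'; rewrite /= !innerE mulr_sumr -big_split /=;
  apply: eq_bigr => i _; rewrite !mxE.
  by rewrite mulrDl mulrA.
by rewrite rmorphD rmorphM /= mulrDr mulrCA.
Qed.

HB.instance Definition _ := bilinear_isBilinear.Build _ _ _ _ _ _
  (@inner R K n) inner_bilinear.

Fact inner_hermitian x y :
  inner x y = (-1) ^+ false * scalar_conj (inner y x).
Proof.
rewrite expr0 mul1r !innerE rmorph_sum; apply: eq_bigr => i _.
by rewrite rmorphM /= scalar_conjK mulrC.
Qed.

HB.instance Definition _ := isHermitianSesquilinear.Build _ _ _ _
  (@inner R K n) inner_hermitian.

End Inner.

Definition orthocomp (R : realType) (K : base_field) n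
    (S : {vspace 'cV[field_of R K]_n}) : {vspace 'cV[field_of R K]_n} :=
  orthov (@inner R K n) S.

Section Index.
Variables (F : fieldType) (n : nat).
Implicit Types (A : 'M[F]_n) (S : {vspace 'cV[F]_n}).

Definition mximage A S : {vspace 'cV[F]_n} := (linfun (mulmx A) @: S)%VS.

(* The truncated subtraction is exact, as S <= S + A S. *)
Definition index_inv A S : nat := (\dim (S + mximage A S)%VS - \dim S)%N.

Definition invariant_under A S : bool := (mximage A S <= S)%VS.

End Index.

Section Powers.
Variables (R : realType) (K : base_field) (n : nat).
Implicit Types (A B U : 'M[field_of R K]_n) (l : 'rV[R]_n).

Definition hermitian_mx A : bool := A \is hermitianmx n false scalar_conj.

Definition posdef A : Prop :=
  hermitian_mx A /\ forall x : 'cV_n, x != 0 -> 0 < inner (A *m x) x.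

Definition unitary_mx U : bool := U *m U^H == 1%:M.

Definition is_posdef_pow A (s : R) B : Prop :=
  exists U l, [/\ unitary_mx U, (forall i, 0 < l 0 i),
    A = U *m diag_mx (map_mx of_real l) *m U^H &
    B = U *m diag_mx (map_mx (fun x => of_real (x `^ s)) l) *m U^H].

(* Written A^s; posdef_spectral gives existence and posdef_powE independence
   of the diagonalization when A is positive definite. The value is junk
   otherwise. *)
Definition posdef_pow A (s : R) : 'M[field_of R K]_n :=
  xget 0 (is_posdef_pow A s).

End Powers.

Section Membership.
Variables (R : realType) (K : base_field) (n : nat).
Implicit Types (A : 'M[field_of R K]_n) (S : {vspace 'cV[field_of R K]_n}).

Lemma mem_orthocomp S x :
  x \in orthocomp S <-> {in S, forall y, inner x y = 0}.
Proof. by split=> [/mem_orthovP|?] //; apply/mem_orthovP. Qed.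

Lemma mem_mximage A S y :
  y \in mximage A S <-> exists2 x, x \in S & y = A *m x.
Proof.
split=> [/memv_imgP[x Sx ->]|[x Sx ->]]; first by exists x; rewrite ?lfunE.
by rewrite -[A *m x](lfunE (mulmx A)) memv_img.
Qed.

Lemma invariant_underP A S : invariant_under A S <-> {in S, forall x, A *m x \in S}.
Proof.
split=> [/subvP AS x Sx|AS]; first by apply/AS/mem_mximage; exists x.
by apply/subvP => _ /mem_mximage[x Sx ->]; exact: AS.
Qed.

End Membership.

Section ConjTranspose.
Variables (R : realType) (K : base_field).
Implicit Types m n p : nat.

Lemma ctrmxM m n p (A : 'M[field_of R K]_(m, n)) (B : 'M_(n, p)) :
  (A *m B)^H = B^H *m A^H.
Proof. by rewrite /ctrmx trmx_mul map_mxM. Qed.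

Lemma ctrmxK m n (A : 'M[field_of R K]_(m, n)) : A^H^H = A.
Proof. by apply/matrixP => i j; rewrite !mxE scalar_conjK. Qed.

Lemma unitary_mxP n (U : 'M[field_of R K]_n) :
  reflect (U *m U^H = 1%:M) (unitary_mx U).
Proof. exact: eqP. Qed.

Lemma unitary_mxC n (U : 'M[field_of R K]_n) : unitary_mx U -> U^H *m U = 1%:M.
Proof. by move/unitary_mxP/mulmx1C. Qed.

Lemma hermitian_mxP n (A : 'M[field_of R K]_n) :
  reflect (A = A^H) (hermitian_mx A).
Proof.
by apply: (iffP (is_hermitianmxP _ _ _)); rewrite expr0 scale1r.
Qed.

Lemma of_real_inj : injective (@of_real R K).
Proof. exact: fmorph_inj. Qed.

Lemma of_real_gt0 (x : R) : (0 < @of_real R K x) = (0 < x).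
Proof. by case: K => //=; rewrite -ltcR. Qed.

End ConjTranspose.
Arguments unitary_mxP {R K n U}.
Arguments hermitian_mxP {R K n A}.

(* The value of U diag(l ^ s) U^H depends on U diag(l) U^H only. *)
Lemma posdef_powE (R : realType) (K : base_field) n
    (U : 'M[field_of R K]_n) (l : 'rV[R]_n) (s : R) :
  unitary_mx U -> (forall i, 0 < l 0 i) ->
  posdef_pow (U *m diag_mx (map_mx of_real l) *m U^H) s =
  U *m diag_mx (map_mx (fun x => of_real (x `^ s)) l) *m U^H.
Proof.
move=> unU l0; set A := U *m _ *m _.
have : is_posdef_pow A s (posdef_pow A s).
  by apply: xgetPex; exists (U *m diag_mx (map_mx
    (fun x => of_real (x `^ s)) l) *m U^H); exists U, l; split.
case=> V [m [unV m0 eqA ->]]; set X := diag_mx _; set Y := diag_mx _.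
pose W := V^H *m U.
have WD i j : W i j * of_real (l 0 j) = of_real (m 0 i) * W i j.
  have /matrixP/(_ i j) : W *m diag_mx (map_mx of_real l) =
      diag_mx (map_mx of_real m) *m W.
    have := congr1 (fun M => V^H *m M *m U) eqA.
    rewrite /A !mulmxA (unitary_mxC unV) mul1mx.
    by rewrite -(mulmxA _ U^H) (unitary_mxC unU) mulmx1 -!mulmxA.
  by rewrite mul_mx_diag mul_diag_mx !mxE.
have VW : V *m W = U by rewrite mulmxA (unitary_mxP unV) mul1mx.
have WX : X *m W = W *m Y.
  clearbody W.
  rewrite mul_mx_diag mul_diag_mx; apply/matrixP => i j; rewrite !mxE.
  have [->|W0] := eqVneq (W i j) 0; first by rewrite mulr0 mul0r.
  have /of_real_inj -> : of_real (l 0 j) = of_real (m 0 i) :> field_of R K.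
    by apply: (mulfI W0); rewrite WD mulrC.
  by rewrite mulrC.
have VHE : V^H = W *m U^H by rewrite -mulmxA (unitary_mxP unU) mulmx1.
by rewrite VHE mulmxA -(mulmxA V) WX mulmxA VW.
Qed.

Section RealSymmetric.
Variable R : realType.

Lemma symmetric_eigenvector n (A : 'M[R]_n.+1) : A^T = A ->
  exists (v : 'rV_n.+1) (a : R), v *m A = a *: v /\ v *m v^T = 1%:M.
Proof.
move=> symA; pose AC := map_mx (real_complex R) A.
have hermA : AC \is hermsymmx.
  apply/is_hermitianmxP; rewrite expr0 scale1r.
  apply/matrixP => i j; rewrite !mxE /= conj_Creal ?complex_real //.
  by rewrite -[in LHS]symA mxE.
have := hermitian_normalmx hermA => /orthomx_spectralP eqAC.
have /mxOverP/(_ 0 0) Rd := hermitian_spectral_diag_real hermA.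
set P := spectralmx AC in eqAC; set d := spectral_diag AC in eqAC Rd.
have Pu : P \in unitmx by exact: spectral_unit.
have [a da] : exists a : R, d 0 0 = real_complex R a.
  by have /complex_realP := Rd.
have : eigenvalue AC (real_complex R a).
  apply/eigenvalueP; exists (row 0 P).
    rewrite -da eqAC -row_mul !mulmxA mulmxV // mul1mx row_mul.
    by rewrite row_diag_mx -scalemxAl -rowE.
  by apply: contraTneq Pu => P0; rewrite -row_free_unit -kermx_eq0;
     apply/rowV0Pn; exists (delta_mx 0 0);
     [apply/sub_kermxP; rewrite -rowE|
      apply/eqP => /matrixP/(_ 0 0); rewrite !mxE !eqxx; apply/eqP/oner_neq0].
rewrite eigenvalue_root_char -map_char_poly fmorph_root
  -eigenvalue_root_char => /eigenvalueP[v vA v0].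
have vv : v *m v^T = (\sum_i v 0 i ^+ 2)%:M.
  by apply/matrixP => i j; rewrite !ord1 !mxE mulr1n; apply: eq_bigr => k _;
     rewrite !mxE.
set t := \sum_i _ in vv; have t0 : 0 < t.
  rewrite lt_def sumr_ge0 ?andbT => [|i _]; last exact: sqr_ge0.
  apply: contra v0 => /eqP /psumr_eq0P z; apply/eqP/rowP => i; rewrite mxE.
  by apply/eqP; rewrite -sqrf_eq0 z // => j _; exact: sqr_ge0.
exists ((Num.sqrt t)^-1 *: v), a; split.
  by rewrite -scalemxAl vA !scalerA mulrC.
rewrite linearZ /= -scalemxAl -scalemxAr scalerA vv scale_scalar_mx.
by rewrite -invfM -expr2 sqr_sqrtr ?ltW // mulVf ?gt_eqF.
Qed.

(* The Householder reflection through the hyperplane orthogonal to e_1 - v. *)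
Lemma orthogonal_extension n (v : 'rV[R]_n.+1) : v *m v^T = 1%:M ->
  exists H : 'M[R]_n.+1, [/\ H^T = H, H *m H = 1%:M & row 0 H = v].
Proof.
move=> vv; pose e : 'rV[R]_n.+1 := delta_mx 0 0.
pose w := e - v; pose c := (w *m w^T) 0 0.
have wwE : w *m w^T = c%:M by rewrite [LHS]mx11_scalar.
have cE : c = (1 - v 0 0) *+ 2.
  have : e *m e^T = 1%:M by rewrite trmx_delta mul_delta_mx;
    apply/matrixP => i j; rewrite !ord1 !mxE.
  rewrite /c /w linearB /= mulmxBl !mulmxBr vv => ->.
  rewrite trmx_delta -rowE -colE !mxE !eqxx !mulr1n.
  by rewrite opprB mulr2n.
have w0 : c = 0 -> w = 0.
  rewrite /c mxE => /psumr_eq0P z; apply/rowP => i; rewrite [RHS]mxE.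
  apply/eqP; rewrite -sqrf_eq0 expr2; apply/eqP.
  have w2 j : xpredT j -> 0 <= w 0 j * w^T j 0.
    by rewrite [w^T _ _]mxE -expr2 sqr_ge0.
  by have := z w2 i isT; rewrite [w^T _ _]mxE.
have ew : e *m w^T = (1 - v 0 0)%:M.
  by rewrite -rowE; apply/matrixP => i j; rewrite !ord1 !mxE !eqxx.
have vE : v = e - w by rewrite /w subKr.
clearbody c w.
pose H := 1%:M - (2 / c) *: (w^T *m w); exists H; split.
- by rewrite /H linearB /= trmx1 linearZ /= trmx_mul trmxK.
- rewrite /H mulmxBl mul1mx mulmxBr mulmx1 -scalemxAl -scalemxAr.
  rewrite mulmxA -(mulmxA _ w) wwE mul_mx_scalar -scalemxAl !scalerA.
  have [c0|c0] := eqVneq c 0.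
    by rewrite c0 invr0 !(mulr0, mul0r) !scale0r !subr0.
  by rewrite divfK // mulr_natr mulr2n scalerDl opprB addrK subrK.
- rewrite rowE /H mulmxBr mulmx1 -scalemxAr mulmxA -/e.
  have [c0|c0] := eqVneq c 0.
    by rewrite c0 invr0 mulr0 scale0r subr0 vE w0 ?subr0.
  rewrite ew mul_scalar_mx scalerA mulrAC mulr_natl -cE divff // scale1r.
  by rewrite -vE.
Qed.

End RealSymmetric.

Theorem symmetric_spectral (R : realType) n (A : 'M[R]_n) : A^T = A ->
  exists (U : 'M[R]_n) (l : 'rV[R]_n),
    U *m U^T = 1%:M /\ A = U *m diag_mx l *m U^T.
Proof.
elim: n A => [|n IHn] A symA.
  by exists 1%:M, 0; rewrite !(flatmx0 A) !mul1mx; split; apply/matrixP => -[].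
have [v [a [vA vv]]] := symmetric_eigenvector symA.
have [H [symH HH rowH]] := orthogonal_extension vv.
have [B BE] : exists B : 'M_(1 + n), B = H *m A *m H by exists (H *m A *m H).
have symB : B^T = B by rewrite BE !trmx_mul symH symA mulmxA.
have rowB : row 0 B = a *: delta_mx 0 0.
  by rewrite BE !row_mul rowH vA -scalemxAl -rowH -row_mul HH row1.
have Bul : ulsubmx B = a%:M.
  apply/matrixP => i j; rewrite !ord1 !mxE.
  have /rowP/(_ 0) := rowB; rewrite !mxE !eqxx mulr1 mulr1n => <-.
  by congr (B _ _); apply/val_inj.
have Bur : ursubmx B = 0.
  apply/matrixP => i j; rewrite !ord1 !mxE.
  have /rowP/(_ (rshift 1 j)) := rowB; rewrite !mxE mulr0 => <-.
  by congr (B _ _); apply/val_inj.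
have Bdl : dlsubmx B = 0 by rewrite -[B]symB -trmx_ursub Bur trmx0.
have symD : (drsubmx B)^T = drsubmx B by rewrite trmx_drsub symB.
have [U [l [UU eqD]]] := IHn _ symD.
pose V : 'M_(1 + n) := block_mx 1%:M 0 0 U.
have eqB : B = V *m diag_mx (row_mx a%:M l) *m V^T.
  rewrite -[LHS]submxK Bul Bur Bdl eqD diag_mx_row /V tr_block_mx.
  rewrite !mulmx_block !(trmx0, trmx1, mulmx0, mul0mx, mulmx1, mul1mx,
    addr0, add0r).
  by congr block_mx; apply/matrixP => i j; rewrite !ord1 !mxE.
have VV : V *m V^T = 1%:M.
  rewrite /V tr_block_mx mulmx_block.
  rewrite !(trmx0, trmx1, mulmx0, mul0mx, mulmx1, mul1mx, addr0, add0r).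
  by rewrite UU -scalar_mx_block.
exists (H *m V), (row_mx a%:M l); rewrite trmx_mul symH; split.
  by rewrite mulmxA -(mulmxA H) VV mulmx1.
have := congr1 (fun M => H *m M *m H) eqB.
rewrite BE !mulmxA HH mul1mx -(mulmxA A) HH mulmx1 => ->.
by rewrite -!mulmxA.
Qed.

Theorem hermitian_spectral (R : realType) (K : base_field) n
    (A : 'M[field_of R K]_n) : hermitian_mx A ->
  exists (U : 'M[field_of R K]_n) (l : 'rV[R]_n),
    unitary_mx U /\ A = U *m diag_mx (map_mx of_real l) *m U^H.
Proof.
case: K A => A /hermitian_mxP hA.
  have /symmetric_spectral[U [l [UU eqA]]] : A^T = A.
    by rewrite [RHS]hA; apply/matrixP => i j; rewrite !mxE.
  have UH : @ctrmx R Reals n n U = U^T by apply/matrixP => i j; rewrite !mxE.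
  exists U, l; split; first by apply/unitary_mxP; rewrite UH.
  by rewrite UH map_mx_id.
have hermA : (A : 'M[R[i]]_n) \is hermsymmx.
  by apply/is_hermitianmxP; rewrite expr0 scale1r.
have /hermitian_normalmx/orthomx_spectralP := hermA.
rewrite invmx_unitary ?spectral_unitarymx //.
have /mxOverP Rd := hermitian_spectral_diag_real hermA.
have := spectral_unitarymx (A : 'M[R[i]]_n).
set P := spectralmx _; set d := spectral_diag _ in Rd * => unP eqA.
pose Q : 'M[field_of R Complexes]_n := P.
exists Q^H, (map_mx (@complex.Re R) d); split.
  by apply/unitary_mxP; rewrite ctrmxK; apply: mulmx1C; exact/unitarymxP.
rewrite ctrmxK [LHS]eqA; congr (_ *m diag_mx _ *m _).
by apply/rowP => i; rewrite !mxE /= RRe_real.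
Qed.

Theorem posdef_spectral (R : realType) (K : base_field) n
    (A : 'M[field_of R K]_n) : posdef A ->
  exists (U : 'M[field_of R K]_n) (l : 'rV[R]_n),
    [/\ unitary_mx U, forall i, 0 < l 0 i &
        A = U *m diag_mx (map_mx of_real l) *m U^H].
Proof.
case=> /hermitian_spectral[U [l [unU eqA]]] A0; exists U, l; split=> // i.
have AU : A *m col i U = of_real (l 0 i) *: col i U.
  rewrite !colE mulmxA eqA -(mulmxA _ U^H U) (unitary_mxC unU) mulmx1 -!colE.
  by rewrite mul_mx_diag; apply/colP => k; rewrite !mxE mulrC.
have UUi : inner (col i U) (col i U) = 1.
  rewrite /inner; have /matrixP/(_ i i) := unitary_mxC unU.
  by rewrite !mxE eqxx mulr1n => <-; apply: eq_bigr => k _; rewrite !mxE.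
have := A0 (col i U); rewrite AU linearZl_LR /= UUi mulr1 of_real_gt0; apply.
apply/eqP => U0; have := UUi; rewrite U0 innerE big1 => [/eqP|k _].
  by rewrite eq_sym oner_eq0.
by rewrite mxE mul0r.
Qed.

(* Main.v *)
(* Rank-nullity gives Ind_A(S) = dim S - dim (S :&: A^-1 S). Dualizing, the
   complement of S^perp + A S^perp is S :&: (A^H)^-1 S, so that
   Ind_A(S^perp) = Ind_(A^H)(S). The space S' complements S in S + A S, hence
   has dimension Ind_A(S), and S + A S + A (S + A S) = (S + A S) + A S'. For A
   Hermitian, S' :&: A^-1 S' = 0, so S' attains the maximal index dim S'.
   For A positive definite, A^s is a polynomial in A, by interpolation on the
   eigenvalues. *)

Require Import Defs.
From mathcomp Require Import all_boot all_order all_algebra.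
From mathcomp Require Import complex.
From mathcomp Require Import boolp classical_sets reals exp.
From mathcomp Require Import zify.

Set Implicit Arguments.
Unset Strict Implicit.
Unset Printing Implicit Defensive.

Import Order.TTheory GRing.Theory Num.Theory.

Local Open Scope ring_scope.

(** * The index of invariance over an arbitrary field *)

Section LinearAlgebra.
Variables (F : fieldType) (n : nat).
Implicit Types (A B : 'M[F]_n) (S T : {vspace 'cV[F]_n}).

Definition mxpreim A S : {vspace 'cV[F]_n} := (linfun (mulmx A) @^-1: S)%VS.

Lemma mem_mxpreim A S x : (x \in mxpreim A S) = (A *m x \in S).
Proof. by rewrite -memv_preim lfunE. Qed.

Lemma mximageP A S y :
  reflect (exists2 x, x \in S & y = A *m x) (y \in mximage A S).
Proof.
by apply: (iffP memv_imgP) => -[x Sx ->]; exists x; rewrite ?lfunE.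
Qed.

Lemma mximage_sub A S T :
  reflect {in S, forall x, A *m x \in T} (mximage A S <= T)%VS.
Proof.
apply: (iffP subvP) => [AST x Sx|AST y /mximageP[x Sx ->]]; last exact: AST.
by apply/AST/mximageP; exists x.
Qed.

Lemma dim_leq_n S : (\dim S <= n)%N.
Proof. by have := dimvS (subvf S); rewrite dimvf /dim /= muln1. Qed.

Lemma mximageD A S T : mximage A (S + T) = (mximage A S + mximage A T)%VS.
Proof. exact: limgD. Qed.

Lemma dim_mximage_le A S : (\dim (mximage A S) <= \dim S)%N.
Proof. by rewrite -(limg_ker_dim (linfun (mulmx A)) S) leq_addl. Qed.

Lemma dim_mximage_unit A S : A \in unitmx -> \dim (mximage A S) = \dim S.
Proof.
move=> uA; apply/limg_dim_eq/eqP; rewrite -subv0; apply/subvP => x.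
rewrite memv_cap memv_ker lfunE /= => /andP[_ /eqP Ax].
by rewrite memv0 -[x](mulKmx uA) Ax mulmx0.
Qed.

Lemma dim_index_inv A S :
  \dim (S + mximage A S) = (\dim S + index_inv A S)%N.
Proof. by rewrite subnKC // dimvS // addvSl. Qed.

Lemma index_inv_le_dim A S : (index_inv A S <= \dim S)%N.
Proof.
have := dimv_sum_cap S (mximage A S); rewrite dim_index_inv.
by have := dim_mximage_le A S; lia.
Qed.

Lemma index_inv_le_codim A S : (index_inv A S <= n - \dim S)%N.
Proof. exact/leq_sub2r/dim_leq_n. Qed.

Lemma index_inv_eq0 A S : (index_inv A S == 0%N) = invariant_under A S.
Proof.
rewrite /invariant_under -[RHS]andTb -(subvv S) -subv_add.
have := dimv_leqif_sup (addvSl S (mximage A S)).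
by case=> le <-; rewrite subn_eq0 eqn_leq le.
Qed.

(* Rank-nullity for the map [S -> (S + A S) / S] induced by [A], whose kernel
   is the intersection of [S] with [A^-1 S]. *)
Lemma index_inv_preim A S :
  (index_inv A S + \dim (S :&: mxpreim A S))%N = \dim S.
Proof.
(* Instead of a quotient map, [A] is restricted to [S] and to [S :&: mxpreim A S]. The two
   restrictions have the same kernel, and their images are [A S] and the intersection of [S] with
   [A S]. *)
have capE : mximage A (S :&: mxpreim A S) = (S :&: mximage A S)%VS.
  apply/vspaceP => y; rewrite memv_cap; apply/mximageP/andP => [[x]|].
    rewrite memv_cap mem_mxpreim => /andP[Sx SAx] ->; split=> //.
    by apply/mximageP; exists x.
  case=> Sy /mximageP[x Sx yE]; exists x => //.
  by rewrite memv_cap mem_mxpreim Sx -yE.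
have kerE : (S :&: mxpreim A S :&: lker (linfun (mulmx A)) =
             S :&: lker (linfun (mulmx A)))%VS.
  apply/vspaceP => x; rewrite !memv_cap mem_mxpreim memv_ker lfunE /=.
  by case: eqP => [->|]; rewrite ?mem0v ?andbF ?andbT.
have := dimv_sum_cap S (mximage A S); rewrite dim_index_inv -capE.
have := limg_ker_dim (linfun (mulmx A)) (S :&: mxpreim A S); rewrite kerE.
have := limg_ker_dim (linfun (mulmx A)) S.
by rewrite /mximage /reverse_coercion; lia.
Qed.

(** For [x] in [S] the vectors [A x] and [(A + w) x] differ by [w x], again in [S], so both matrices
    give the same sum. The reverse inclusion is the shift by [- w]. *)
Lemma index_inv_shift A S w : index_inv (A + w%:M) S = index_inv A S.
Proof.
suff E : (S + mximage (A + w%:M) S = S + mximage A S)%VS.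
  by rewrite /index_inv E.
apply/eqP; rewrite eqEsubv !subv_add !addvSl /=.
have sub (B : 'M[F]_n) y x :
    x \in S -> B *m x + y *: x \in (S + mximage B S)%VS.
  move=> Sx; rewrite addrC memv_add ?memvZ //; apply/mximageP.
  by exists x.
apply/andP; split; apply/mximage_sub => x Sx.
  by rewrite mulmxDl mul_scalar_mx sub.
have := sub (A + w%:M) (- w) x Sx.
by rewrite mulmxDl mul_scalar_mx scaleNr addrK.
Qed.

(** Applying [A], which preserves dimensions, turns the sum of [S] and [A^-1 S] into that of [A S]
    and [S]. *)
Lemma index_inv_invmx A S :
  A \in unitmx -> index_inv (invmx A) S = index_inv A S.
Proof.
move=> uA; suff AV : mximage A (mximage (invmx A) S) = S.
  by rewrite /index_inv -(@dim_mximage_unit A) // mximageD AV addvC.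
apply/vspaceP => y; apply/mximageP/idP => [[x]|Sy].
  by case/mximageP => z Sz -> ->; rewrite mulKVmx.
exists (invmx A *m y); last by rewrite mulKVmx.
by apply/mximageP; exists y.
Qed.

Lemma invariant_invmx A S :
  A \in unitmx -> invariant_under (invmx A) S = invariant_under A S.
Proof. by move=> uA; rewrite -!index_inv_eq0 index_inv_invmx. Qed.

(** Since [A S] already lies in [S + T], only [A T] can enlarge this space, by at most [\dim T]. *)
Lemma index_inv_ext A S T : (S + T = S + mximage A S)%VS ->
  (index_inv A (S + mximage A S) <= \dim T)%N.
Proof.
move=> defT; have AS : (mximage A S <= S + T)%VS by rewrite defT addvSr.
rewrite -defT leq_subLR mximageD addvA (addv_idPl AS).
have := dimv_sum_cap (S + T) (mximage A T); have := dim_mximage_le A T.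
by rewrite /reverse_coercion; lia.
Qed.

End LinearAlgebra.

(** * Functions of a diagonalizable matrix as polynomials in it *)

Section Interpolation.
Variable F : fieldType.

(** Newton's scheme: a new node is fitted by adding a multiple of a polynomial that vanishes at all
    the earlier ones. *)
Lemma poly_interpolation (s : seq F) (f : F -> F) :
  exists p : {poly F}, {in s, forall x, p.[x] = f x}.
Proof.
elim: s => [|a s [p pE]]; first by exists 0.
(* Nodes may repeat; at a repeated node [r] below would vanish and could not be divided by. *)
have [sa|sa] := boolP (a \in s).
  by exists p => x; rewrite inE => /predU1P[->|]; exact: pE.
pose r := \prod_(b <- s) ('X - b%:P).
have ra : r.[a] != 0 by rewrite -[_ == 0]/(root r a) root_prod_XsubC.
exists (p + ((f a - p.[a]) / r.[a]) *: r) => x; rewrite inE !hornerE.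
case/predU1P => [->|sx]; first by rewrite divfK // addrC subrK.
have /rootP -> : root r x by rewrite root_prod_XsubC.
by rewrite mulr0 addr0 pE.
Qed.

Variable n : nat.
Implicit Types (A U V : 'M[F]_n) (d : 'rV[F]_n) (S : {vspace 'cV[F]_n}).

(** As [V] inverts [U], the new matrix is [p] evaluated at the old one; the induction follows
    Horner's rule. *)
Lemma invariant_diag_poly U V d S (p : {poly F}) : V *m U = 1%:M ->
  invariant_under (U *m diag_mx d *m V) S ->
  invariant_under (U *m diag_mx (map_mx (horner p) d) *m V) S.
Proof.
move=> VU /mximage_sub inv; apply/mximage_sub.
have UV : U *m V = 1%:M by exact: mulmx1C.
elim/poly_ind: p => [|p c IHp] x Sx.
  have -> : diag_mx (map_mx (horner 0) d) = 0 :> 'M[F]_n.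
    by apply/matrixP => i j; rewrite !mxE horner0 mul0rn.
  by rewrite mulmx0 !mul0mx mem0v.
suff -> : U *m diag_mx (map_mx (horner (p * 'X + c%:P)) d) *m V =
    (U *m diag_mx d *m V) *m (U *m diag_mx (map_mx (horner p) d) *m V) + c%:M.
  by rewrite mulmxDl mul_scalar_mx memvD ?memvZ // -mulmxA inv ?IHp.
rewrite !mulmxA -(mulmxA _ V U) VU mulmx1 -(mulmxA U (diag_mx d)) mulmx_diag.
have -> : c%:M = U *m c%:M *m V :> 'M_n.
  by rewrite mul_mx_scalar -scalemxAl UV scalemx1.
rewrite -mulmxDl -mulmxDr; congr (_ *m _ *m _); apply/matrixP => i j.
by rewrite !mxE !hornerE -mulrnDl mulrC.
Qed.

(** Only the values of [f] at the entries of [d] matter, and there a polynomial agrees with [f]. *)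
Lemma invariant_diag_fun U V d S (f : F -> F) : V *m U = 1%:M ->
  invariant_under (U *m diag_mx d *m V) S ->
  invariant_under (U *m diag_mx (map_mx f d) *m V) S.
Proof.
move=> VU; have [p pE] := poly_interpolation [seq d 0 i | i : 'I_n] f.
suff -> : map_mx f d = map_mx (horner p) d by exact: invariant_diag_poly.
by apply/rowP => i; rewrite !mxE pE // map_f ?mem_enum.
Qed.

End Interpolation.

(** * Orthogonal complements, adjoints and powers *)

Section Orthogonality.
Variables (R : realType) (K : base_field) (n : nat).
Implicit Types (A : 'M[field_of R K]_n) (S T : {vspace 'cV[field_of R K]_n}).
Implicit Types x y : 'cV[field_of R K]_n.

Lemma inner_eq0C x y : inner x y = 0 -> inner y x = 0.
Proof.
by move=> xy; rewrite inner_hermitian expr0 mul1r xy rmorph0.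
Qed.

Lemma inner_xx_eq0 x : inner x x = 0 -> x = 0.
Proof.
have ge0 (a : field_of R K) : 0 <= a * scalar_conj a.
  by clear; case: K a => a /=; [exact: sqr_ge0|exact: mul_conjC_ge0].
have eq0 (a : field_of R K) : a * scalar_conj a = 0 -> a = 0.
  by move/eqP; rewrite mulf_eq0 fmorph_eq0 orbb => /eqP.
rewrite innerE => /psumr_eq0P x0; apply/colP => i; rewrite [RHS]mxE.
by apply/eq0/x0.
Qed.

Lemma inner_mulmx A x y : inner (A *m x) y = inner x (A^H *m y).
Proof. by rewrite /inner ctrmxM ctrmxK mulmxA. Qed.

Lemma orthocomp_le S T : (S <= T -> orthocomp T <= orthocomp S)%VS.
Proof.
move/subvP => ST; apply/subvP => x /mem_orthocomp Tx.
by apply/mem_orthocomp => y /ST/Tx.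
Qed.

Lemma cap_orthocomp S : (S :&: orthocomp S)%VS = 0%VS.
Proof.
apply/eqP; rewrite -subv0; apply/subvP => x.
by rewrite memv_cap memv0 => /andP[Sx /mem_orthocomp/(_ x Sx)/inner_xx_eq0->].
Qed.

Lemma dim_orthocomp S : \dim (orthocomp S) = (n - \dim S)%N.
Proof.
apply/eqP; rewrite eqn_leq; apply/andP; split.
  have := dim_leq_n (S + orthocomp S); have := dimv_sum_cap S (orthocomp S).
  by rewrite cap_orthocomp dimv0 /reverse_coercion; lia.
(* [M x] lists the inner products of [x] with a basis of [S], so the kernel of [M] lies in the
   complement; rank-nullity bounds its dimension from below. *)
pose M : 'M_(\dim S, n) :=
  \matrix_(i, j) scalar_conj ((vbasis S)`_i j 0).
have ME x i : (M *m x) i 0 = inner x (vbasis S)`_i.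
  by rewrite innerE mxE; apply: eq_bigr => j _; rewrite mxE mulrC.
pose f : 'Hom('cV[field_of R K]_n, 'cV_(\dim S)) := linfun (mulmx M).
have kerM : (lker f <= orthocomp S)%VS.
  apply/subvP => x; rewrite memv_ker lfunE /= => /eqP Mx.
  apply/mem_orthocomp => y Sy; rewrite (coord_vbasis Sy).
  rewrite linear_sumr /= big1 // => i _.
  by rewrite linearZr_LR /= -ME Mx mxE mulr0.
apply: leq_trans (dimvS kerM).
have := limg_ker_dim f fullv.
have := dimvS (subvf (limg f)).
by rewrite capfv !dimvf /dim /= !muln1 /reverse_coercion; lia.
Qed.

Lemma add_orthocomp S : (S + orthocomp S)%VS = fullv.
Proof.
apply/eqP; rewrite -(dimv_leqif_eq (subvf _)).
rewrite dimv_disjoint_sum ?cap_orthocomp // dim_orthocomp dimvf.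
by rewrite subnKC /dim /= ?muln1 // dim_leq_n.
Qed.

Lemma orthocompK S : orthocomp (orthocomp S) = S.
Proof.
apply/eqP; rewrite eq_sym -(dimv_leqif_eq _).
  by rewrite !dim_orthocomp subKn // dim_leq_n.
apply/subvP => x Sx; apply/mem_orthocomp => y /mem_orthocomp Sy.
exact/inner_eq0C/Sy.
Qed.

Lemma orthocompD S T :
  orthocomp (S + T)%VS = (orthocomp S :&: orthocomp T)%VS.
Proof.
apply/eqP; rewrite eqEsubv subv_cap !orthocomp_le ?addvSl ?addvSr //=.
apply/subvP => x /memv_capP[/mem_orthocomp Sx /mem_orthocomp Tx].
apply/mem_orthocomp => _ /memv_addP[y Sy [z Tz ->]].
by rewrite linearDr /= Sx // Tx // addr0.
Qed.

Lemma orthocomp_mximage A S :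
  orthocomp (mximage A S) = mxpreim A^H (orthocomp S).
Proof.
apply/vspaceP => x; rewrite mem_mxpreim.
apply/idP/idP => /mem_orthocomp h; apply/mem_orthocomp => y.
  move=> Sy; rewrite inner_mulmx ctrmxK h //.
  by apply/mximageP; exists y.
by case/mximageP => z Sz ->; have := h z Sz; rewrite inner_mulmx ctrmxK.
Qed.

Lemma index_inv_orthocomp A S : index_inv A (orthocomp S) = index_inv A^H S.
Proof.
have := index_inv_preim A^H S.
have -> : (S :&: mxpreim A^H S)%VS =
    orthocomp (orthocomp S + mximage A (orthocomp S))%VS.
  by rewrite orthocompD orthocomp_mximage orthocompK.
rewrite dim_orthocomp dim_index_inv dim_orthocomp.
have := index_inv_le_codim A (orthocomp S); rewrite dim_orthocomp.
have := dim_leq_n S.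
by rewrite /reverse_coercion; lia.
Qed.

(* For [x] in [S' = orthocomp S :&: (S + A S)] with [A x] orthogonal to [S],
   [x] is orthogonal to both [S] and [A S], hence to itself. *)
Lemma index_inv_cap_orthocomp A S : hermitian_mx A ->
  index_inv A (orthocomp S :&: (S + mximage A S))%VS =
  \dim (orthocomp S :&: (S + mximage A S))%VS.
Proof.
move=> /hermitian_mxP hA; set S' := (_ :&: _)%VS.
rewrite -[RHS](index_inv_preim A).
suff -> : (S' :&: mxpreim A S' = 0)%VS by rewrite dimv0 addn0.
apply/eqP; rewrite -subv0; apply/subvP => x.
rewrite memv_cap mem_mxpreim [A *m x \in _]memv_cap memv0.
case/and3P => /memv_capP[S'x Tx] SAx _.
rewrite (inner_xx_eq0 (x := x)) //.
suff /mem_orthocomp/(_ x Tx) : x \in orthocomp (S + mximage A S)%VS by [].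
by rewrite orthocompD memv_cap S'x orthocomp_mximage mem_mxpreim -hA.
Qed.

(** The modular law applies because [S] lies in [S + A S], and [S] and its complement span
    everything. *)
Lemma add_cap_orthocomp A S :
  (S + (orthocomp S :&: (S + mximage A S)) = S + mximage A S)%VS.
Proof. by rewrite vspace_modl ?addvSl // add_orthocomp capfv. Qed.

Lemma dim_cap_orthocomp A S :
  \dim (orthocomp S :&: (S + mximage A S))%VS = index_inv A S.
Proof.
rewrite /index_inv -{2}(add_cap_orthocomp A S) dimv_disjoint_sum ?addKn //.
by rewrite capvA cap_orthocomp cap0v.
Qed.

(** Index zero is invariance, which passes from [A] to every function of its eigenvalues. *)
Lemma index_inv_posdef_pow A S s : posdef A ->
  index_inv A S = 0%N -> index_inv (posdef_pow A s) S = 0%N.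
Proof.
move=> /posdef_spectral[U [l [unU l0 ->]]] /eqP; rewrite index_inv_eq0 => inv.
apply/eqP; rewrite index_inv_eq0 posdef_powE //.
(* [f] carries the real power over to the scalar field through a real preimage of [z]. The default
   preimage 0 is never taken at the eigenvalues, which are images of reals. *)
pose f (z : field_of R K) : field_of R K :=
  of_real ((xget 0 [set a : R | of_real a = z]%classic) `^ s).
suff -> : map_mx (fun a : R => of_real (a `^ s)) l = map_mx f (map_mx of_real l).
  by apply: invariant_diag_fun inv; exact: unitary_mxC.
apply/rowP => i; rewrite !mxE /f.
by case: xgetP => [a _ /of_real_inj->|/(_ (l 0 i) erefl)].
Qed.

End Orthogonality.

(** Two numbers with sum [m] cannot both exceed [m / 2]; for [p > m] the truncated difference is
    0. *)
Lemma minn_subn_half (p m : nat) : (minn p (m - p) <= m %/ 2)%N.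
Proof. lia. Qed.

(** * The five assertions, assembled from the dimension counts *)

Theorem lemma2p18 (R : realType) (K : base_field) (n : nat) (n_ge1 : (1 <= n)%N)
    (A : 'M[field_of R K]_n) (S : {vspace 'cV[field_of R K]_n}) (p q : nat)
    (dimS : \dim S = p) (indS : q = index_inv A S) :
  let S' := (orthocomp S :&: (S + mximage A S))%VS in
  (* (i) *)
  (forall omega : field_of R K, index_inv (A + omega%:M) S = q) /\
  (* (ii) *)
  ((index_inv A (orthocomp S) <= minn p (n - p))%N /\
   (minn p (n - p) <= n %/ 2)%N /\
   (index_inv A (S + mximage A S)%VS <= minn q (n - p - q))%N /\
   (minn q (n - p - q) <= (n - p) %/ 2)%N /\
   (index_inv A S' <= q)%N) /\
  (* (iii) *)
  (A \in unitmx -> index_inv (invmx A) S = q) /\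
  (* (iv) *)
  (hermitian_mx A ->
     index_inv A (orthocomp S) = q /\
     index_inv A S' = q /\
     (q = 0%N ->
        invariant_under A S /\ invariant_under A (orthocomp S) /\
        (A \in unitmx ->
           invariant_under (invmx A) S /\ invariant_under (invmx A) (orthocomp S)))) /\
  (* (v) *)
  (posdef A -> index_inv A S = 0%N ->
     forall s : R, index_inv (posdef_pow A s) S = 0%N).
Proof.
move=> S'; have indS' : \dim S' = q by rewrite dim_cap_orthocomp.
have defS' : (S + S' = S + mximage A S)%VS := add_cap_orthocomp A S.
have p_le_n : (p <= n)%N by rewrite -dimS dim_leq_n.
split; first by move=> w; rewrite index_inv_shift.
split.
  split.
    (* The complement of [S] has dimension [n - p], hence codimension [p]; these are the two general
       bounds on its index. *)
    rewrite leq_min -{2}dimS -dim_orthocomp index_inv_le_dim andbT.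
    have := index_inv_le_codim A (orthocomp S).
    by rewrite dim_orthocomp dimS subKn.
  split; first exact: minn_subn_half.
  split.
    (* The bound [q] comes from extending [S] by [S'], the other from the codimension of
       [S + A S]. *)
    rewrite leq_min -indS' (index_inv_ext defS') indS'.
    have := index_inv_le_codim A (S + mximage A S).
    by rewrite dim_index_inv -indS dimS subnDA.
  split; first exact: minn_subn_half.
  by rewrite -indS' index_inv_le_dim.
split; first by move=> uA; rewrite index_inv_invmx.
split; last by move=> posA indS0 s; exact: index_inv_posdef_pow.
move=> hA; have indSo : index_inv A (orthocomp S) = q.
  by rewrite index_inv_orthocomp -(hermitian_mxP hA).
split=> //; split; first by rewrite index_inv_cap_orthocomp.
move=> q0; have invS : invariant_under A S by rewrite -index_inv_eq0 -indS q0.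
have invSo : invariant_under A (orthocomp S) by rewrite -index_inv_eq0 indSo q0.
by split=> //; split=> // uA; rewrite !invariant_invmx.
Qed.
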